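(* Let $A\in\mathbb{C}^{n\times n}$, let $\widehat V\in\mathbb{C}^{n\times n}$ be invertible, and let $\widehat D=\mathrm{diag}(\widehat d_1,\dots,\widehat d_n)$ be diagonal with complex entries. Define $$R:=A\widehat V-\widehat V\widehat D,\quad Y=[y_{ij}]:=\widehat V^{-1}R,\quad Y_{\mathrm d}:=\mathrm{diag}(y_{11},\dots,y_{nn}),\quad \widetilde D=\mathrm{diag}(\widetilde d_1,\dots,\widetilde d_n):=\widehat D+Y_{\mathrm d}.$$ Assume that the right-only refinement algorithm described in the context is executed in exact arithmetic on $(A,\widehat V,\widehat D)$ and that its simple-eigenvalue branch is taken. Let $\widetilde E=[\widetilde e_{ij}]$ be the correction matrix computed by it, that is, $\widetilde e_{ii}=0$ and $\widetilde e_{ij}=y_{ij}/(\widetilde d_j-\widetilde d_i)$ for $i\neq j$, and let $\widetilde V=\widehat V(I+\widetilde E)$. Then $$\mathrm{sep}(\widetilde D):=\min_{i\neq j}|\widetilde d_i-\widetilde d_j|>0,$$ the updated residual satisfies the exact identity $$\widehat V^{-1}(A\widetilde V-\widetilde V\widetilde D)=Y\widetilde E-Y_{\mathrm d}\widetilde E,$$ and therefore $$\|\widehat V^{-1}(A\widetilde V-\widetilde V\widetilde D)\|_F\le \frac{2\|Y\|_F^2}{\mathrm{sep}(\widetilde D)}.$$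
   Context: $\|\cdot\|_F$ is the Frobenius norm, and all computations are in exact arithmetic. The dimension satisfies $n\ge 2$, so that the minimum over $i\ne j$ makes sense. Right-only refinement algorithm. Input: $A\in\mathbb{C}^{n\times n}$, invertible $\widehat V\in\mathbb{C}^{n\times n}$, diagonal $\widehat D=\mathrm{diag}(\widehat d_1,\dots,\widehat d_n)$, and a chosen threshold $\tau>0$. (1) $R\gets A\widehat V-\widehat V\widehat D$. (2) $Y\gets\widehat V^{-1}R$. (3) $\widetilde d_i\gets\widehat d_i+y_{ii}$ for $i=1,\dots,n$. (4) If $\min_{i\ne j}|\widetilde d_i-\widetilde d_j|<\tau$, leave this algorithm (a separate procedure for clustered eigenvalues is used instead). Otherwise the simple-eigenvalue branch is taken and the algorithm continues. (5) $\widetilde e_{ii}\gets 0$, and $\widetilde e_{ij}\gets y_{ij}/(\widetilde d_j-\widetilde d_i)$ for $i\neq j$; $\widetilde E\gets[\widetilde e_{ij}]$. (6) $\widetilde V\gets\widehat V(I+\widetilde E)$ and $\widetilde D\gets\mathrm{diag}(\widetilde d_1,\dots,\widetilde d_n)$. (7) Return $(\widetilde V,\widetilde D)$. *)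

(* Defs.v *)
From mathcomp Require Import all_boot all_order all_algebra.
From mathcomp Require Import reals complex.

Set Implicit Arguments.
Unset Strict Implicit.
Unset Printing Implicit Defensive.

Import Order.TTheory GRing.Theory Num.Theory.

Local Open Scope ring_scope.

(* [Normc.normc z] is the modulus of [z] as an element of [R], whereas [`|z|]
   lives in [R[i]]. *)
Definition frobenius (R : realType) (m n : nat) (A : 'M[R[i]]_(m, n)) : R :=
  Num.sqrt (\sum_(i < m) \sum_(j < n) Normc.normc (A i j) ^+ 2).

Definition diag_gaps (R : realType) (n : nat) (D : 'M[R[i]]_n) : seq R :=
  [seq Normc.normc (D p.1 p.1 - D p.2 p.2) |
     p in [pred p : 'I_n * 'I_n | p.1 != p.2]].

(* For 2 <= n the list of gaps is nonempty, so the initial value of the iterated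
   minimum is itself a gap and does not affect it; for n < 2 the value is 0. *)
Definition sep (R : realType) (n : nat) (D : 'M[R[i]]_n) : R :=
  \big[Num.min/head 0 (diag_gaps D)]_(x <- diag_gaps D) x.

(* [None] means that the algorithm is left for the clustered-eigenvalue
   procedure; [Some (V, D)] is the pair returned by the simple-eigenvalue
   branch. *)
Definition right_only_refinement (R : realType) (n : nat) (tau : R)
    (A Vh : 'M[R[i]]_n) (dh : 'rV[R[i]]_n) :
    option ('M[R[i]]_n * 'M[R[i]]_n) :=
  let Res := A *m Vh - Vh *m diag_mx dh in
  let Y := invmx Vh *m Res in
  let dt := \row_i (dh 0 i + Y i i) in
  if sep (diag_mx dt) < tau then None
  else
    let Et := \matrix_(i, j)
      (if i == j then 0 else Y i j / (dt 0 j - dt 0 i)) in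
    Some (Vh *m (1%:M + Et), diag_mx dt).

(* Main.v *)
Require Import Defs.
From mathcomp Require Import all_boot all_order all_algebra.
From mathcomp Require Import reals complex spectral.

Set Implicit Arguments.
Unset Strict Implicit.
Unset Printing Implicit Defensive.

Import Order.TTheory GRing.Theory Num.Theory.
Local Open Scope ring_scope.

(** Put [Yd] for the diagonal part of [Y] and [Dt = Dh + Yd].  Since
    [A *m Vh = Vh *m (Dh + Y)], the updated residual seen through [invmx Vh] is
    [(Dh + Y) *m (1 + E) - (1 + E) *m Dt], which regroups as
    [(Dt *m E - E *m Dt + (Y - Yd)) + (Y *m E - Yd *m E)].  The division by
    [Dt j j - Dt i i] is what makes [E] solve the Sylvester equation
    [E *m Dt - Dt *m E = Y - Yd]: the first-order terms cancel, and only the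
    quadratic remainder [(Y - Yd) *m E] is left
    ([sylvester_off_diag], [refined_residual]).

    Being on the simple-eigenvalue branch means [tau <= sep Dt], so every gap is
    positive and the divisions are legitimate.  For the estimate, [sep] is below
    every gap, so [E] is entrywise dominated by [Y] divided by [sep]
    ([frobenius_le_scale]); submultiplicativity of the Frobenius norm
    ([frobenius_mulmx]) does the rest.  Because [Y - Yd] is entrywise dominated
    by [Y], its norm is at most that of [Y], and the bound comes out with the
    constant 1 in place of 2. *)

Lemma normc_ge0 (R : realType) (z : R[i]) : 0 <= Normc.normc z.
Proof. by case: z => a b; exact: sqrtr_ge0. Qed.

Lemma frobenius_ge0 (R : realType) (m n : nat) (A : 'M[R[i]]_(m, n)) :
  0 <= frobenius A.
Proof. exact: sqrtr_ge0. Qed.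

Lemma frobenius_sqr (R : realType) (m n : nat) (A : 'M[R[i]]_(m, n)) :
  frobenius A ^+ 2 = \sum_(i < m) \sum_(j < n) Normc.normc (A i j) ^+ 2.
Proof.
rewrite sqr_sqrtr //.
by apply: sumr_ge0 => i _; apply: sumr_ge0 => j _; exact: sqr_ge0.
Qed.

Lemma frobenius_le_scale (R : realType) (m n : nat) (c : R)
    (A B : 'M[R[i]]_(m, n)) : 0 <= c ->
  (forall i j, Normc.normc (A i j) <= c * Normc.normc (B i j)) ->
  frobenius A <= c * frobenius B.
Proof.
move=> c0 leAB.
have cB0 : 0 <= c * frobenius B by rewrite mulr_ge0 ?frobenius_ge0.
rewrite -(ler_pXn2r (n := 2)) ?nnegrE ?frobenius_ge0 //.
rewrite exprMn !frobenius_sqr mulr_sumr; apply: ler_sum => i _.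
rewrite mulr_sumr; apply: ler_sum => j _.
by rewrite -exprMn lerXn2r ?nnegrE ?mulr_ge0 ?normc_ge0.
Qed.

(** This is the Cauchy-Schwarz inequality for the Hermitian product [dotmx] of
    the [i]-th row of [A] with the conjugate of the [j]-th column of [B]. *)
Lemma normc_mulmx_sqr (R : realType) (m n p : nat)
    (A : 'M[R[i]]_(m, n)) (B : 'M[R[i]]_(n, p)) (i : 'I_m) (j : 'I_p) :
  Normc.normc ((A *m B) i j) ^+ 2 <=
    (\sum_(k < n) Normc.normc (A i k) ^+ 2) *
    (\sum_(k < n) Normc.normc (B k j) ^+ 2).
Proof.
pose u := row i A; pose v := \row_k (B k j)^*.
have normcR (z : R[i]) : (Normc.normc z ^+ 2)%:C%C = z * z^*.
  by rewrite -normCK rmorphXn.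
have uvE : dotmx u v = (A *m B) i j.
  by rewrite dotmxE !mxE; apply: eq_bigr => k _; rewrite !mxE conjCK.
have uuE : dotmx u u = (\sum_(k < n) Normc.normc (A i k) ^+ 2)%:C%C.
  rewrite dotmxE !mxE rmorph_sum; apply: eq_bigr => k _ /=.
  by rewrite normcR !mxE.
have vvE : dotmx v v = (\sum_(k < n) Normc.normc (B k j) ^+ 2)%:C%C.
  rewrite dotmxE !mxE rmorph_sum; apply: eq_bigr => k _ /=.
  by rewrite normcR !mxE conjCK mulrC.
have : `|dotmx u v| ^+ 2 <= dotmx u u * dotmx v v.
  by have [le_uv _] := CauchySchwarz (@dotmx _ n) u v; exact: le_uv.
by rewrite uuE vvE uvE normCK -normcR -rmorphM lecR.
Qed.

Lemma frobenius_mulmx (R : realType) (m n p : nat)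
    (A : 'M[R[i]]_(m, n)) (B : 'M[R[i]]_(n, p)) :
  frobenius (A *m B) <= frobenius A * frobenius B.
Proof.
have AB0 : 0 <= frobenius A * frobenius B by rewrite mulr_ge0 ?frobenius_ge0.
rewrite -(ler_pXn2r (n := 2)) ?nnegrE ?frobenius_ge0 //.
rewrite exprMn !frobenius_sqr mulr_suml; apply: ler_sum => i _.
rewrite [X in _ * X]exchange_big mulr_sumr; apply: ler_sum => j _.
exact: normc_mulmx_sqr.
Qed.

Lemma sep_le_gap (R : realType) (n : nat) (D : 'M[R[i]]_n) (i j : 'I_n) :
  i != j -> sep D <= Normc.normc (D i i - D j j).
Proof.
move=> neq_ij; apply: (ge_bigmin_seq _ _ _ id) => //.
by apply/imageP; exists (i, j).
Qed.

Lemma diag_neq_of_sep (R : realType) (n : nat) (D : 'M[R[i]]_n) (i j : 'I_n) :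
  0 < sep D -> i != j -> D i i != D j j.
Proof.
move=> sep0 neq_ij; have := lt_le_trans sep0 (sep_le_gap _ neq_ij).
by apply: contraTneq => ->; rewrite subrr Normc.normc0 ltxx.
Qed.

(** Off the diagonal, entry [(i, j)] of the left-hand side is
    [E i j * (d 0 j - d 0 i)], so the division in [E] is undone; on the diagonal
    both sides vanish. *)
Lemma sylvester_off_diag (F : fieldType) (n : nat) (d : 'rV[F]_n)
    (Y E : 'M[F]_n) :
  (forall i j, i != j -> d 0 i != d 0 j) ->
  E = \matrix_(i, j) (if i == j then 0 else Y i j / (d 0 j - d 0 i)) ->
  E *m diag_mx d - diag_mx d *m E = Y - diag_mx (\row_i Y i i).
Proof.
move=> d_inj ->; apply/matrixP => i j.
rewrite mul_mx_diag mul_diag_mx !mxE.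
case: eqP => [->|/eqP neq_ij]; first by rewrite mul0r mulr0 !subrr.
rewrite mulr0n subr0 [d 0 i * _]mulrC -mulrBr divfK // subr_eq0.
by rewrite eq_sym d_inj.
Qed.

(** Conjugating by [V] turns [A] into [D + Y], and substituting the Sylvester
    equation for [E *m (D + Yd)] cancels every term that is not a product of
    [E] with [Y] or [Yd]. *)
Lemma refined_residual (F : fieldType) (n : nat) (A V D Y Yd E : 'M[F]_n) :
  V \in unitmx -> Y = invmx V *m (A *m V - V *m D) ->
  E *m (D + Yd) - (D + Yd) *m E = Y - Yd ->
  let V' := V *m (1%:M + E) in
  invmx V *m (A *m V' - V' *m (D + Yd)) = Y *m E - Yd *m E.
Proof.
move=> Vu defY sylv V'.
have VAV : invmx V *m A *m V = D + Y.
  by rewrite defY mulmxBr !mulmxA mulVmx // mul1mx addrC subrK.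
rewrite /V' mulmxBr !mulmxA VAV mulVmx // mul1mx.
rewrite mulmxDr mulmx1 [(1%:M + E) *m _]mulmxDl mul1mx.
have -> : E *m (D + Yd) = Y - Yd + (D + Yd) *m E by rewrite -sylv subrK.
have -> : D + Yd + (Y - Yd + (D + Yd) *m E) = D + Y + (D + Yd) *m E.
  by rewrite addrA -[D + Yd + _]addrA [Yd + _]addrC subrK.
rewrite opprD addrACA subrr add0r -!mulmxBl.
by rewrite opprD addrACA subrr add0r.
Qed.

Theorem proposition1 (R : realType) (n : nat) (hn : (2 <= n)%N)
    (A Vh : 'M[R[i]]_n) (hVh : Vh \in unitmx) (dh : 'rV[R[i]]_n)
    (tau : R) (htau : 0 < tau) :
  let Dh := diag_mx dh in
  let Res := A *m Vh - Vh *m Dh in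
  let Y := invmx Vh *m Res in
  let Yd := diag_mx (\row_i Y i i) in
  let Dt := Dh + Yd in
  let Et := \matrix_(i, j)
    (if i == j then 0 else Y i j / (Dt j j - Dt i i)) in
  let Vt := Vh *m (1%:M + Et) in
  right_only_refinement tau A Vh dh = Some (Vt, Dt) ->
  [/\ 0 < sep Dt,
      invmx Vh *m (A *m Vt - Vt *m Dt) = Y *m Et - Yd *m Et
    & frobenius (invmx Vh *m (A *m Vt - Vt *m Dt))
        <= 2 * frobenius Y ^+ 2 / sep Dt].
Proof.
move=> Dh Res Y Yd Dt Et Vt; rewrite /right_only_refinement -/Dh -/Res -/Y.
set dt := \row_i _; case: ltP => // tau_le [_ dtE].
have sep0 : 0 < sep Dt by rewrite -dtE (lt_le_trans htau).
have DtE i : Dt i i = dt 0 i by rewrite -dtE mxE eqxx.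
have dt_inj i j : i != j -> dt 0 i != dt 0 j.
  by rewrite -!DtE; exact: diag_neq_of_sep.
have sylv : Et *m Dt - Dt *m Et = Y - Yd.
  rewrite -dtE; apply: sylvester_off_diag dt_inj _.
  by apply/matrixP => i j; rewrite [LHS]mxE [RHS]mxE !DtE.
have resE := refined_residual hVh (erefl : Y = _) sylv.
split=> //; rewrite resE -mulmxBl.
have leYd : frobenius (Y - Yd) <= frobenius Y.
  rewrite -[frobenius Y]mul1r; apply: frobenius_le_scale => // i j.
  rewrite mul1r !mxE; case: eqP => [->|_]; last by rewrite mulr0n subr0.
  by rewrite mulr1n subrr Normc.normc0 normc_ge0.
have leEt : frobenius Et <= (sep Dt)^-1 * frobenius Y.
  apply: frobenius_le_scale => [|i j]; first by rewrite invr_ge0 ltW.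
  rewrite mxE; case: eqP => [_|/eqP neq_ij].
    by rewrite Normc.normc0 mulr_ge0 ?normc_ge0 ?invr_ge0 // ltW.
  rewrite Normc.normcM Normc.normcV mulrC ler_wpM2r ?normc_ge0 //.
  have gap : sep Dt <= Normc.normc (Dt j j - Dt i i).
    by apply: sep_le_gap; rewrite eq_sym.
  by rewrite lef_pV2 // posrE (lt_le_trans sep0 gap).
apply: le_trans (frobenius_mulmx _ _) _.
apply: (le_trans (ler_pM (frobenius_ge0 _) (frobenius_ge0 _) leYd leEt)).
(* The product bound is [frobenius Y ^+ 2 / sep Dt]; the factor 2 is slack. *)
rewrite mulrCA -expr2 mulrC ler_wpM2r ?invr_ge0 ?(ltW sep0) //.
by rewrite ler_peMl ?sqr_ge0 // ler1n.
Qed.
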